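(* Let $(K_{i,j})_{i,j\ge1}$ and $(J_{i,j})_{i,j\ge 1}$ be real numbers with $0\le K_{i,j}=K_{j,i}$ and $0\le J_{i,j}=J_{j,i}$ for all $i,j\ge1$. Let $(a^0,b^0)\in X_1^+\times X_1^+$, and let $(a,b)$ be a solution on $[0,\infty)$ of the coagulation--annihilation system with rates $K$, $J$ and initial data $(a^0,b^0)$ such that $(a(t),b(t))\in X_1^+\times X_1^+$ for all $t\ge0$. Then there exist sequences $(\bar a,\bar b)=((\bar a_i)_{i\ge1},(\bar b_i)_{i\ge1})\in X_1^+\times X_1^+$ such that $$\lim_{t\to\infty}a_i(t)=\bar a_i,\qquad\lim_{t\to\infty}b_i(t)=\bar b_i\qquad\text{for all }i\ge1 .$$ Moreover, if $K_{i,i}>0$ for all $i\ge1$, then $\bar a_i=0$ and $\bar b_i=0$ for all $i\ge1$.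
   Context: For $p\in\mathbb{R}$, $X_p$ is the space of real sequences $x=(x_i)_{i\ge1}$ with $\|x\|_p=\sum_{i=1}^\infty i^p|x_i|<\infty$, and $X_p^+=\{x\in X_p: x_i\ge0\text{ for all }i\ge1\}$. The coagulation--annihilation system is, for $i\in\mathbb{N}=\{1,2,\dots\}$ and $t>0$, $$\frac{da_i}{dt}=\frac12\sum_{j=1}^{i-1}K_{j,i-j}a_ja_{i-j}-\sum_{j=1}^\infty K_{i,j}a_ia_j-\sum_{j=1}^\infty J_{i,j}a_ib_j,\qquad \frac{db_i}{dt}=\frac12\sum_{j=1}^{i-1}K_{j,i-j}b_jb_{i-j}-\sum_{j=1}^\infty K_{i,j}b_ib_j-\sum_{j=1}^\infty J_{i,j}b_ia_j,$$ with $a_i(0)=a_i^0\ge0$, $b_i(0)=b_i^0\ge0$ (for $i=1$ the first sums are zero). Solution: a pair $(a,b)=((a_i)_{i\ge1},(b_i)_{i\ge1})$ of sequences of non-negative functions is a solution on $[0,\infty)$ with initial data $(a^0,b^0)$ if (1) $a_i,b_i\in C([0,\infty))$ for each $i\in\mathbb{N}$; (2) for each $i\in\mathbb{N}$ and $t\ge0$, the functions $\sum_{j=1}^\infty K_{i,j}a_j$, $\sum_{j=1}^\infty K_{i,j}b_j$, $\sum_{j=1}^\infty J_{i,j}a_j$, $\sum_{j=1}^\infty J_{i,j}b_j$ belong to $L^1(0,t)$; (3) for each $i\in\mathbb{N}$ and $t>0$, $$a_i(t)=a_i^0+\int_0^t\Big(\tfrac12\sum_{j=1}^{i-1}K_{j,i-j}a_j(s)a_{i-j}(s)-a_i(s)\sum_{j=1}^\infty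 K_{i,j}a_j(s)-a_i(s)\sum_{j=1}^\infty J_{i,j}b_j(s)\Big)ds,$$ $$b_i(t)=b_i^0+\int_0^t\Big(\tfrac12\sum_{j=1}^{i-1}K_{j,i-j}b_j(s)b_{i-j}(s)-b_i(s)\sum_{j=1}^\infty K_{i,j}b_j(s)-b_i(s)\sum_{j=1}^\infty J_{i,j}a_j(s)\Big)ds.$$ *)

(* Defs.v *)
From HB Require Import structures.
From mathcomp Require Import all_boot all_order all_algebra.
From mathcomp Require Import all_classical all_reals all_analysis.
Set Implicit Arguments.
Unset Strict Implicit.
Unset Printing Implicit Defensive.
Import Order.TTheory GRing.Theory Num.Theory.
Import numFieldNormedType.Exports.
Local Open Scope classical_set_scope.
Local Open Scope ring_scope.

(* Sequences indexed by {1, 2, ...} are functions on nat whose value at 0 is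
   never used: every sum and every quantifier starts at 1. *)

Definition Xnorm (R : realType) (p : R) (x : nat -> R) : \bar R :=
  (\sum_(1 <= i <oo) (i%:R `^ p * `|x i|)%:E)%E.

Definition X (R : realType) (p : R) : set (nat -> R) :=
  [set x | (Xnorm p x < +oo)%E].

Definition Xplus (R : realType) (p : R) : set (nat -> R) :=
  [set x | X p x /\ forall i, (1 <= i)%N -> 0 <= x i].

Definition rate_kernel (R : realType) (K : nat -> nat -> R) : Prop :=
  forall i j, (1 <= i)%N -> (1 <= j)%N -> 0 <= K i j /\ K i j = K j i.

(* [a j s] is the concentration a_j(s).  For s >= 0 the terms are nonnegative,
   so the series always has a value in [0, +oo]. *)
Definition rate_sum (R : realType) (K : nat -> nat -> R) (a : nat -> R -> R)
    (i : nat) (s : R) : \bar R :=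
  (\sum_(1 <= j <oo) (K i j * a j s)%:E)%E.

(* Right-hand side of the a_i-equation; exchanging [a] and [b] gives that of
   the b_i-equation. *)
Definition reaction (R : realType) (K J : nat -> nat -> R)
    (a b : nat -> R -> R) (i : nat) (s : R) : \bar R :=
  ((2^-1 * \sum_(1 <= j < i) K j (i - j)%N * a j s * a (i - j)%N s)%:E
   - (a i s)%:E * rate_sum K a i s
   - (a i s)%:E * rate_sum J b i s)%E.

(* Membership of rate_sum in L^1(0, t) makes it finite almost everywhere, so
   the values of [reaction] where some series diverges do not affect the
   integrals.  The values of a and b at negative times are irrelevant. *)
Record is_solution (R : realType) (K J : nat -> nat -> R) (a0 b0 : nat -> R)
    (a b : nat -> R -> R) : Prop := IsSolution {
  sol_nonneg : forall i (t : R), (1 <= i)%N -> 0 <= t -> 0 <= a i t /\ 0 <= b i t;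
  sol_continuous : forall i, (1 <= i)%N ->
    {within `[0, +oo[, continuous (a i)} /\
    {within `[0, +oo[, continuous (b i)};
  sol_integrable : forall i (t : R), (1 <= i)%N -> 0 <= t ->
    [/\ lebesgue_measure.-integrable `]0, t[ (rate_sum K a i),
        lebesgue_measure.-integrable `]0, t[ (rate_sum K b i),
        lebesgue_measure.-integrable `]0, t[ (rate_sum J a i) &
        lebesgue_measure.-integrable `]0, t[ (rate_sum J b i)];
  sol_equation : forall i (t : R), (1 <= i)%N -> 0 < t ->
    ((a i t)%:E = (a0 i)%:E +
       \int[lebesgue_measure]_(s in `]0%R, t[) reaction K J a b i s)%E /\
    ((b i t)%:E = (b0 i)%:E +
       \int[lebesgue_measure]_(s in `]0%R, t[) reaction K J b a i s)%E }.

(* Main.v *)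
(* Coagulation and annihilation only move mass from the sizes 1, ..., n to larger
   sizes or destroy it, so the partial mass sum_(i <= n) i a_i(t) is
   nonincreasing for every n and converges as t -> +oo. Differences of
   consecutive partial masses give the limits of the a_i, and the partial masses
   at time 1 bound the X_1-norm of the limit. Moreover the n-th partial mass
   decreases at rate at least n K_(n,n) a_n^2, the loss due to collisions of two
   n-clusters; if K_(n,n) > 0 and the limit of a_n were positive, the partial
   mass would become negative. *)

Require Import Defs.
From HB Require Import structures.
From mathcomp Require Import all_boot all_order all_algebra.
From mathcomp Require Import all_classical all_reals all_analysis.
From mathcomp Require Import measurable_realfun ring lra.

Set Implicit Arguments.
Unset Strict Implicit.
Unset Printing Implicit Defensive.
Import Order.TTheory GRing.Theory Num.Theory.
Import numFieldNormedType.Exports.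
Local Open Scope classical_set_scope.
Local Open Scope ring_scope.

(** * Truncated first moment of the coagulation terms *)

(** Exchanging the sums over the triangle j < i <= n and substituting i = j + k makes the range
    symmetric in j and k. *)
Lemma sum_convolution (V : nmodType) (G : nat -> nat -> V) (n : nat) :
  \sum_(1 <= i < n.+1) \sum_(1 <= j < i) G j (i - j)%N =
  \sum_(1 <= j < n.+1) \sum_(1 <= k < n.+1 | (j + k <= n)%N) G j k.
Proof.
under eq_big_nat => i /andP[_ ilt].
  rewrite (big_nat_widen _ _ n.+1) 1?ltnW//.
over.
rewrite (exchange_big_dep_nat xpredT)//=.
apply: eq_big_nat => j /andP[j1 jn].
transitivity (\sum_(j.+1 <= i < n.+1) G j (i - j)%N).
  by rewrite (big_nat_widenl j.+1 1).
rewrite -{1}(add1n j) big_addn.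
rewrite (big_nat_widen 1 _ n.+1) ?leq_subr//.
apply: eq_big => [k|k _]; first by rewrite /= ltn_subRL ltnS.
by rewrite addnK.
Qed.

(* By symmetry the gain is the sum of j K_(j,k) x_j x_k over j + k <= n, so what
   remains of the loss is the sum over j + k > n, which contains (n, n). *)
Lemma truncated_moment_le (R : realFieldType) (K : nat -> nat -> R)
    (x : nat -> R) (n : nat) :
  (forall i j, (1 <= i)%N -> (1 <= j)%N -> 0 <= K i j /\ K i j = K j i) ->
  (forall i, (1 <= i)%N -> 0 <= x i) -> (1 <= n)%N ->
  \sum_(1 <= i < n.+1) i%:R *
    (2^-1 * (\sum_(1 <= j < i) K j (i - j)%N * x j * x (i - j)%N)
     - x i * \sum_(1 <= j < n.+1) K i j * x j) <= - (n%:R * K n n * x n ^+ 2).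
Proof.
move=> hK x0 n1.
pose H j k := K j k * x j * x k.
have H0 j k : (1 <= j)%N -> (1 <= k)%N -> 0 <= H j k.
  by move=> j1 k1; rewrite !mulr_ge0 ?x0//; have [] := hK _ _ j1 k1.
have HC j k : (1 <= j)%N -> (1 <= k)%N -> H j k = H k j.
  by move=> j1 k1; rewrite /H; have [_ ->] := hK _ _ j1 k1; rewrite mulrAC.
pose P j k := (j + k <= n)%N.
pose T := \sum_(1 <= j < n.+1) \sum_(1 <= k < n.+1 | P j k) j%:R * H j k.
have gainE : \sum_(1 <= i < n.+1) i%:R *
    (2^-1 * \sum_(1 <= j < i) K j (i - j)%N * x j * x (i - j)%N) = T.
  (* The weight i is split as j + (i - j), which becomes j + k after the substitution. *)
  transitivity (2^-1 * \sum_(1 <= i < n.+1) \sum_(1 <= j < i)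
      ((j + (i - j))%:R * H j (i - j)%N)).
    rewrite big_distrr/=; apply: eq_big_nat => i _.
    rewrite mulrCA; congr (_ * _); rewrite big_distrr/=.
    by apply: eq_big_nat => j /andP[_ ji]; rewrite subnKC 1?ltnW.
  rewrite (@sum_convolution _ (fun j k => (j + k)%:R * H j k)).
  suff -> : \sum_(1 <= j < n.+1) \sum_(1 <= k < n.+1 | P j k) (j + k)%:R * H j k
      = T + T by lra.
  have TE : T = \sum_(1 <= j < n.+1) \sum_(1 <= k < n.+1 | P j k) k%:R * H j k.
    rewrite /T (exchange_big_dep_nat xpredT)//=.
    apply: eq_big_nat => j /andP[j1 _].
    rewrite [LHS]big_nat_cond [RHS]big_nat_cond.
    apply: eq_big => [k|k /andP[/andP[k1 _] _]]; first by rewrite /P addnC.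
    by rewrite HC.
  rewrite {2}TE /T -big_split/=; apply: eq_bigr => j _.
  by rewrite -big_split/=; apply: eq_bigr => k _; rewrite natrD mulrDl.
under eq_bigr do rewrite mulrBr.
rewrite sumrB gainE.
have lossE : \sum_(1 <= i < n.+1) i%:R * (x i * \sum_(1 <= j < n.+1) K i j * x j)
  = T + \sum_(1 <= j < n.+1) \sum_(1 <= k < n.+1 | ~~ P j k) j%:R * H j k.
  rewrite -big_split/=; apply: eq_bigr => j _.
  rewrite mulrA big_distrr/= (bigID (P j))/=.
  by congr (_ + _); apply: eq_bigr => k _; rewrite /H; ring.
rewrite lossE opprD addNKr lerN2.
(* The last outer and then the last inner term are split off to isolate (n, n); all other terms are
   nonnegative. *)
rewrite big_nat_recr//= [leRHS]addrC big_mkcond/= big_nat_recr//=.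
have -> : ~~ P n n by rewrite /P -ltnNge -{1}(addn0 n) ltn_add2l.
rewrite /H expr2 !mulrA [X in _ <= X + _]addrC.
rewrite -addrA lerDl addr_ge0//.
  rewrite big_nat_cond sumr_ge0// => k /andP[/andP[k1 _] _].
  by case: ifP => // _; rewrite mulr_ge0// H0.
rewrite big_nat_cond sumr_ge0// => j /andP[/andP[j1 _] _].
rewrite big_nat_cond sumr_ge0// => k /andP[/andP[k1 _] _].
by rewrite mulr_ge0// H0.
Qed.

(** * Bounds on the right-hand side and its integrability *)

Section reaction_bounds.
Context (R : realType).
Implicit Types (K J : nat -> nat -> R) (a b : nat -> R -> R).

Lemma rate_sum_ge K a i n (s : R) : (forall j, (1 <= j)%N -> 0 <= K i j) ->
  (forall j, (1 <= j)%N -> 0 <= a j s) ->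
  ((\sum_(1 <= j < n) K i j * a j s)%:E <= rate_sum K a i s)%E.
Proof.
move=> K0 a_ge0; rewrite -sumEFin; apply: nneseries_lim_ge => j j1 _.
by rewrite lee_fin mulr_ge0 ?K0 ?a_ge0.
Qed.

(** Dropping the annihilation loss and the tail of the coagulation loss only increases the
    right-hand side. The cut-off n is independent of i, so one cut-off can serve a whole partial
    mass. *)
Lemma reaction_le K J a b i n (s : R) :
  (forall j, (1 <= j)%N -> 0 <= K i j) -> (forall j, (1 <= j)%N -> 0 <= J i j) ->
  (forall j, (1 <= j)%N -> 0 <= a j s) -> (forall j, (1 <= j)%N -> 0 <= b j s) ->
  (1 <= i)%N ->
  (reaction K J a b i s <=
    (2^-1 * (\sum_(1 <= j < i) K j (i - j)%N * a j s * a (i - j)%N s)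
     - a i s * \sum_(1 <= j < n) K i j * a j s)%:E)%E.
Proof.
move=> K0 J0 a_ge0 b_ge0 i1; rewrite /reaction EFinB.
rewrite -[leRHS]sube0 leeB//; last first.
  rewrite mule_ge0 ?lee_fin ?a_ge0//.
  (* The empty truncation gives nonnegativity of the annihilation sum. *)
  by have := @rate_sum_ge J b i 0%N s J0 b_ge0; rewrite big_geq.
by rewrite leeB// EFinM lee_wpmul2l ?lee_fin ?a_ge0// rate_sum_ge.
Qed.

End reaction_bounds.

(* A finite integral forces both the positive and the negative part to have
   finite integral, since +oo - +oo = -oo in \bar R. *)
Lemma integral_fin_num_integrable d (T : measurableType d) (R : realType)
    (mu : {measure set T -> \bar R}) (D : set T) (f : T -> \bar R) :
  measurable D -> measurable_fun D f ->
  (\int[mu]_(x in D) f x)%E \is a fin_num -> mu.-integrable D f.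
Proof.
move=> mD mf; rewrite integralE => fin.
apply/integrableP; split=> //.
have -> : (\int[mu]_(x in D) `|f x|)%E =
    (\int[mu]_(x in D) (f^\+ x + f^\- x))%E.
  by apply: eq_integral => x _; rewrite -[LHS]/((abse \o f) x) fune_abse.
rewrite ge0_integralD//; [|exact: measurable_funepos|exact: measurable_funeneg].
have p0 : (0 <= \int[mu]_(x in D) f^\+ x)%E by exact: integral_ge0.
have q0 : (0 <= \int[mu]_(x in D) f^\- x)%E by exact: integral_ge0.
by move: p0 q0 fin; case: (\int[mu]_(x in D) f^\+ x)%E => [r| |] //;
   case: (\int[mu]_(x in D) f^\- x)%E => [r'| |] // _ _ _; rewrite -EFinD ltry.
Qed.

Definition partial_mass (R : realType) (a : nat -> R -> R) (n : nat) (t : R) :=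
  \sum_(1 <= i < n.+1) i%:R * a i t.

(** Lets every result on [a] be applied to [b]. *)
Lemma is_solution_sym (R : realType) (K J : nat -> nat -> R)
    (a0 b0 : nat -> R) (a b : nat -> R -> R) :
  is_solution K J a0 b0 a b -> is_solution K J b0 a0 b a.
Proof.
case=> nn ct it eqn; split=> [i t i1 t0|i i1|i t i1 t0|i t i1 t0].
- by have [? ?] := nn i t i1 t0.
- by have [? ?] := ct i i1.
- by have [? ? ? ?] := it i t i1 t0.
- by have [? ?] := eqn i t i1 t0.
Qed.

(** * Decay of the partial masses *)

Section decay.
Context (R : realType) (K J : nat -> nat -> R).
Context (a0 b0 : nat -> R) (a b : nat -> R -> R).
Context (hK : rate_kernel K) (hJ : rate_kernel J).
Context (hsol : is_solution K J a0 b0 a b).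

Let a_ge0 i (t : R) : (1 <= i)%N -> 0 <= t -> 0 <= a i t.
Proof. by move=> i1 t0; have [] := sol_nonneg hsol i1 t0. Qed.

Let b_ge0 i (t : R) : (1 <= i)%N -> 0 <= t -> 0 <= b i t.
Proof. by move=> i1 t0; have [] := sol_nonneg hsol i1 t0. Qed.

Lemma measurable_concentration i (t : R) : (1 <= i)%N ->
  measurable_fun `]0, t[ (a i).
Proof.
move=> i1; apply: (@measurable_funS _ _ _ _ (`[0, +oo[ : set R)) => //.
  by apply: subset_itv; rewrite bnd_simp.
by apply: subspace_continuous_measurable_fun => //; exact: (sol_continuous hsol i1).1.
Qed.

(** The integral equation expresses a finite value through this integral, so the integral is finite;
    with measurability this yields integrability. *)
Lemma integrable_reaction i (t : R) : (1 <= i)%N -> 0 < t ->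
  lebesgue_measure.-integrable `]0, t[ (reaction K J a b i).
Proof.
move=> i1 t0; apply: integral_fin_num_integrable => //.
  have [/integrableP[mKa _] _ _ /integrableP[mJb _]] :=
    sol_integrable hsol i1 (ltW t0).
  have ma := measurable_concentration.
  have mgain : measurable_fun `]0, t[
      (fun u : R => \sum_(1 <= j < i) K j (i - j)%N * a j u * a (i - j)%N u).
    (* [measurable_sum] asks for every term to be measurable, but j = 0 and j >= i would reach
       concentrations of index 0; the guard replaces those terms by 0. *)
    rewrite (_ : (fun u : R => _) = fun u : R => \sum_(j <- index_iota 1 i)
        if (1 <= j < i)%N then K j (i - j)%N * a j u * a (i - j)%N u else 0); last first.
      by apply/funext => u /=; apply: eq_big_nat => j ji; rewrite ji.
    apply: measurable_sum => j; case: (boolP (1 <= j < i)%N) => // /andP[j1 ji].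
    apply: measurable_funM; last by apply: ma; rewrite subn_gt0.
    by apply: measurable_funM => //; exact: ma.
  apply: emeasurable_funB; first apply: emeasurable_funB.
  - by apply/measurable_EFinP; apply: measurable_funM.
  - by apply: emeasurable_funM => //; apply/measurable_EFinP; exact: ma.
  - by apply: emeasurable_funM => //; apply/measurable_EFinP; exact: ma.
have [aE _] := sol_equation hsol i1 t0.
have : (a i t)%:E \is a fin_num by [].
by rewrite aE fin_numD => /andP[_].
Qed.

Lemma integral_reaction i (s t : R) : (1 <= i)%N -> 0 < s -> s < t ->
  (\int[lebesgue_measure]_(u in `]s, t[) reaction K J a b i u)%E =
  (a i t - a i s)%:E.
Proof.
move=> i1 s0 st; have t0 := lt_trans s0 st.
have int_t := integrable_reaction i1 t0.
have int_s := integrable_reaction i1 s0.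
have [asE _] := sol_equation hsol i1 s0.
have [atE _] := sol_equation hsol i1 t0.
have tE : [set` `]0, t[] = `]0, s] `|` `]s, t[ :> set R.
  by rewrite -itv_bndbnd_setU// bnd_simp// ltW.
move: atE; rewrite tE integral_setU//=; last 2 first.
- by rewrite -tE; case/integrableP : int_t.
- apply/disj_setPS => x [] /=; rewrite !in_itv/= => /andP[_ xs] /andP[sx _].
  by rewrite ltNge xs in sx.
(* The point s is a null set, so the equation at time s applies. *)
rewrite -integral_itv_bndo_bndc; last by case/integrableP : int_s.
rewrite addeA -asE => atE.
by rewrite EFinB atE addeAC subee// add0e.
Qed.

(** The weighted sum of the first n equations is integrated over []s, t[], where its integrand is at
    most -c. The case c = 0 gives monotonicity, and c > 0 a linear loss. *)
Lemma partial_mass_decay n (s t c : R) : (1 <= n)%N -> 0 < s -> s < t ->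
  (forall u, s < u < t -> c <= n%:R * K n n * a n u ^+ 2) ->
  partial_mass a n t <= partial_mass a n s - c * (t - s).
Proof.
move=> n1 s0 st hc.
pose D : set R := [set` `]s, t[].
have mD : measurable D by exact: measurable_itv.
have int_r i : lebesgue_measure.-integrable D (reaction K J a b i.+1).
  apply: integrableS (@integrable_reaction i.+1 t isT (lt_trans s0 st)) => //.
  by rewrite /D; apply: subset_itv; rewrite bnd_simp// ltW.
have int_ir i : lebesgue_measure.-integrable D
    (fun u => (i.+1%:R%:E * reaction K J a b i.+1 u)%E).
  by apply: integrableZl => //; exact: int_r.
have massE : (\int[lebesgue_measure]_(u in D)
    (\sum_(0 <= i < n) (i.+1%:R%:E * reaction K J a b i.+1 u)))%E =
    (partial_mass a n t - partial_mass a n s)%:E.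
  rewrite integral_sum// /partial_mass -sumrB big_add1/= -sumEFin.
  apply: eq_bigr => i _; rewrite integralZl//.
  by rewrite integral_reaction// -EFinM mulrBr.
suff : ((partial_mass a n t - partial_mass a n s)%:E <= (- c * (t - s))%:E)%E.
  by rewrite lee_fin; lra.
rewrite -massE.
have -> : (- c * (t - s))%:E =
    (\int[lebesgue_measure]_(u in D) (cst (- c)%:E) u)%E.
  rewrite integral_cst//= lebesgue_measure_itv/= lte_fin st.
  by rewrite -EFinB -EFinM.
apply: le_integral => //.
- by apply: integrable_sum => // i _; exact: int_ir.
- apply/integrableP; split=> //.
  rewrite integral_cst//= lebesgue_measure_itv/= lte_fin st.
  by rewrite -EFinB -EFinM ltry.
move=> u; rewrite inE /D /= in_itv/= => /andP[su ut].
have u0 : 0 <= u by rewrite ltW// (lt_trans s0).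
have au j : (1 <= j)%N -> 0 <= a j u by move=> ?; exact: a_ge0.
have bu j : (1 <= j)%N -> 0 <= b j u by move=> ?; exact: b_ge0.
apply: (@le_trans _ _ (- (n%:R * K n n * a n u ^+ 2))%:E); last first.
  by rewrite lee_fin lerN2 hc// su.
(* The intermediate bound is the truncated moment; [reaction_le] is applied to each size with the
   same cut-off. *)
apply: (@le_trans _ _ _%:E); last first.
  by rewrite lee_fin; exact: (@truncated_moment_le _ K (fun i => a i u)).
rewrite big_add1/= -sumEFin; apply: lee_sum => i _.
rewrite EFinM lee_wpmul2l ?lee_fin//.
by apply: reaction_le => // j j1; [have [] := hK (isT : 1 <= i.+1)%N j1|
  have [] := hJ (isT : 1 <= i.+1)%N j1].
Qed.

Lemma partial_mass_ge0 n (t : R) : 0 <= t -> 0 <= partial_mass a n t.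
Proof.
move=> t0; rewrite /partial_mass big_nat_cond sumr_ge0// => i /andP[/andP[i1 _] _].
by rewrite mulr_ge0// a_ge0.
Qed.

Lemma partial_mass_nonincreasing n (s t : R) : 0 < s -> s <= t ->
  partial_mass a n t <= partial_mass a n s.
Proof.
move=> s0; rewrite le_eqVlt => /predU1P[->//|st].
case: n => [|n]; first by rewrite /partial_mass !big_geq.
have := @partial_mass_decay n.+1 s t 0 isT s0 st; rewrite mul0r subr0; apply.
move=> u _; rewrite mulr_ge0 ?sqr_ge0// mulr_ge0//.
by have [] := hK (isT : 1 <= n.+1)%N (isT : 1 <= n.+1)%N.
Qed.

Lemma partial_mass_cvg n :
  exists m : R, partial_mass a n t @[t --> +oo] --> m.
Proof.
(* Negated and frozen before time 1: the monotone convergence result wants a function nondecreasing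
   on the whole line, while the mass is known to be monotone at positive times. *)
pose f t := - partial_mass a n (Num.max 1 t).
have f_nd : nondecreasing_fun f.
  move=> s t st; rewrite lerN2 partial_mass_nonincreasing//.
    by rewrite lt_max ltr01.
  by rewrite ge_max le_max lexx/= le_max st orbT.
have f_ub : has_ubound (range f).
  exists 0 => _ [t _ <-]; rewrite oppr_le0 partial_mass_ge0//.
  by rewrite le_max ler01.
have fl := nondecreasing_cvgr f_nd f_ub.
exists (- sup (range f)); move/cvgN : fl; apply: cvg_trans.
apply: near_eq_cvg; by near=> t; rewrite /f opprK max_r.
Unshelve. all: by end_near. Qed.

(** * Limits of one species *)

Lemma species_limit : (forall t, 0 <= t -> Xplus 1 (fun i => a i t)) ->
  exists abar : nat -> R,
    [/\ Xplus 1 abar,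
        forall i, (1 <= i)%N -> a i t @[t --> +oo] --> abar i &
        forall i, (1 <= i)%N -> 0 < K i i -> abar i = 0].
Proof.
move=> hX; have [m hm] := choice partial_mass_cvg.
pose abar i : R := (m i - m i.-1) / i%:R.
have a_cvg i : (1 <= i)%N -> a i t @[t --> +oo] --> abar i.
  case: i => // i _.
  have : (partial_mass a i.+1 t - partial_mass a i t) / i.+1%:R
      @[t --> +oo] --> abar i.+1 by exact: cvgMr_tmp (cvgB (hm i.+1) (hm i)).
  apply: cvg_trans; apply: near_eq_cvg; apply: nearW => t /=.
  by rewrite /partial_mass big_nat_recr//= addrAC subrr add0r mulrC mulKf.
have abar_ge0 i : (1 <= i)%N -> 0 <= abar i.
  move=> i1; apply: (cvgr_to_ge (a_cvg i i1)).
  near=> t; apply: a_ge0 => //.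
(* The empty partial mass anchors the telescoping sum below. *)
have m0 : m 0%N = 0.
  apply: (cvg_unique _ (hm 0%N)) => //.
  rewrite (_ : partial_mass a 0 = cst 0); first exact: cvg_cst.
  by apply/funext => t; rewrite /partial_mass big_geq.
have abar_sum n : \sum_(1 <= i < n.+1) i%:R * abar i = m n.
  rewrite big_add1/= -[RHS]subr0 -[in RHS]m0 -telescope_sumr//.
  by apply: eq_bigr => i _; rewrite /abar mulrC divfK.
have m_le n : m n <= partial_mass a n 1.
  apply: (cvgr_to_le (hm n)); near=> t.
  by apply: partial_mass_nonincreasing => //.
exists abar; split => //.
(* Each partial sum of the norm of [abar] is some [m n], hence at most the norm of a(1). *)
- split => //; have [fin _] := hX 1 ler01.
  apply: le_lt_trans fin; apply: lime_le.
    by apply: is_cvg_nneseries => i _ _; rewrite lee_fin mulr_ge0// powR_ge0.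
  apply: nearW => -[|n]; first by rewrite big_geq// nneseries_ge0.
  apply: (@le_trans _ _ (\sum_(1 <= i < n.+1) (i%:R `^ 1 * `|a i 1|)%:E)%E).
    rewrite !sumEFin lee_fin.
    apply: (@le_trans _ _ (m n)).
      rewrite -abar_sum le_eqVlt; apply/predU1P; left.
      by apply: eq_big_nat => i /andP[i1 _]; rewrite powRr1// ger0_norm// abar_ge0.
    apply: (le_trans (m_le n)); rewrite le_eqVlt; apply/predU1P; left.
    by apply: eq_big_nat => i /andP[i1 _]; rewrite powRr1// ger0_norm// a_ge0.
  by apply: nneseries_lim_ge => i _ _; rewrite lee_fin mulr_ge0// powR_ge0.
- move=> n n1 Kn; apply/eqP; rewrite eq_le abar_ge0// andbT leNgt; apply/negP => an0.
  have /(cvgr_gt (abar n)) : a n t @[t --> +oo] --> abar n by exact: a_cvg.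
  move=> /(_ (abar n / 2)); rewrite ltr_pdivrMr// ltr_pMr// ltr1n => /(_ isT).
  move=> [T [_ hT]].
  (* After time s, a_n exceeds half its supposed limit, so the mass is lost at rate at least c. *)
  pose s : R := Num.max 1 T; pose c : R := n%:R * K n n * (abar n / 2) ^+ 2.
  have s0 : 0 < s by rewrite lt_max ltr01.
  have nK0 : 0 < n%:R * K n n by rewrite mulr_gt0 ?ltr0n.
  have c0 : 0 < c by rewrite mulr_gt0// exprn_gt0// divr_gt0.
  have M0 : 0 <= partial_mass a n s by exact/partial_mass_ge0/ltW.
  (* Chosen so that the loss c (t - s) exceeds the mass at s by 1, forcing a mass of at most -1 at
     time t. *)
  pose t := s + (partial_mass a n s + 1) / c.
  have st : s < t by rewrite ltrDl divr_gt0// ltr_wpDl.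
  have := @partial_mass_decay n s t c n1 s0 st.
  have := @partial_mass_ge0 n t (ltW (lt_trans s0 st)).
  rewrite {4}/t addrAC subrr add0r [c * _]mulrC divfK ?gt_eqF// => Mt decay.
  suff /decay : forall u, s < u < t -> c <= n%:R * K n n * a n u ^+ 2 by lra.
  move=> u /andP[su _]; have u0 : 0 <= u by rewrite ltW// (lt_trans s0).
  have au : abar n / 2 < a n u.
    by apply: hT; rewrite (le_lt_trans _ su)// le_max lexx orbT.
  have abar2_ge0 : 0 <= abar n / 2 by rewrite divr_ge0// ltW.
  by rewrite ler_pM2l// ler_sqr ?nnegrE ?a_ge0// ltW.
Unshelve. all: by end_near. Qed.

End decay.

Theorem theorem7p2 (R : realType) (K J : nat -> nat -> R)
    (a0 b0 : nat -> R) (a b : nat -> R -> R)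
    (hK : rate_kernel K) (hJ : rate_kernel J)
    (ha0 : Xplus 1 a0) (hb0 : Xplus 1 b0)
    (hsol : is_solution K J a0 b0 a b)
    (hX : forall t : R, 0 <= t ->
       Xplus 1 (fun i => a i t) /\ Xplus 1 (fun i => b i t)) :
  exists abar bbar : nat -> R,
    [/\ Xplus 1 abar, Xplus 1 bbar,
        forall i, (1 <= i)%N ->
          a i t @[t --> +oo] --> abar i /\ b i t @[t --> +oo] --> bbar i &
        (forall i, (1 <= i)%N -> 0 < K i i) ->
          forall i, (1 <= i)%N -> abar i = 0 /\ bbar i = 0].
Proof.
have [abar [Xa cva abar0]] :=
  species_limit hK hJ hsol (fun t t0 => proj1 (hX t t0)).
have [bbar [Xb cvb bbar0]] :=
  species_limit hK hJ (is_solution_sym hsol) (fun t t0 => proj2 (hX t t0)).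
exists abar, bbar; split=> // [i i1|Kii i i1].
  by split; [exact: cva|exact: cvb].
by split; [exact: abar0 i1 (Kii i i1)|exact: bbar0 i1 (Kii i i1)].
Qed.
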